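(* Consider Non-IID Stochastic Display Ads and a fractional allocation $\mu^t_{ij}\ge0$ such that $x^t_{ij}=f^t_i\mu^t_{ij}$ is feasible for the Stochastic Matching LP constraints. Run the SOCS for Display Ads on this fractional allocation. For agent $j$ and $w>0$ let $y_j(w)=\sum_t\sum_{i:w_{ij}\ge w}f^t_i\mu^t_{ij}$. Then for every agent $j$ and every $w>0$, the probability that no item with $w_{ij}\ge w$ is allocated to $j$ is at most $g(y_j(w))$, where $$g(y)=\min\Big\{e^{-y},\ e^{-y}\Big(1+\tfrac12(y-0.44)^+\Big)e^{-\frac12(y-0.44)^+}+\frac{1-y}{15}\Big\}.$$
   Context: Non-IID Stochastic Display Ads: types $I$, agents $J$, $T$ steps; at each step independently an item of type $i$ arrives with probability $f^t_i$ ($\sum_if^t_i\le1$); the algorithm sees the type and must allocate immediately. Agent $j$ has weights $w_{ij}\ge0$. Stochastic Matching LP constraints: $\sum_jx^t_{ij}\le f^t_i$ for all $i,t$; $\sum_{(t,i)\in S}x^t_{ij}\le1-\prod_{t\in[T]}(1-\sum_{i:(t,i)\in S}f^t_i)$ for all $j\in J$, $S\subseteq[T]\times I$; $x\ge0$. Type Decomposition (type $i$, step $t$): place in $[0,1)$ consecutive left-closed right-open intervals $I_j$ of lengths $\mu^t_{ij}$ in a fixed order of $j$, leftover $I_\perp$ for a dummy agent with zero weights; sample $\eta$ uniform in $[0,\frac12)$, $\eta'=\eta+\frac12$, $\eta\in I_j$, $\eta'\in I_k$; output $i\sim j$ if $j=k$, else $i\sim\{j,k\}$. Two-Way SOCS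 for Display Ads (stateful): on $i\sim\{j,k\}$: pick $m\in\{j,k\}$ uniformly and mark the step with $m$; if it is the second step marked with $m$, select opposite w.r.t. $m$ to the first step marked with $m$ (select $m$ iff $m$ was not selected there); else select $j$ or $k$ uniformly. SOCS for Display Ads: each step draw a surrogate type by Type Decomposition (fresh randomness); for $i\sim j$ allocate to $j$; for $i\sim\{j,k\}$ allocate to the agent chosen by the Two-Way SOCS. *)

(* Defs.v *)
From HB Require Import structures.
From mathcomp Require Import all_boot all_order all_algebra.
From mathcomp Require Import all_classical all_reals all_analysis.

Set Implicit Arguments.
Unset Strict Implicit.
Unset Printing Implicit Defensive.

Import Order.TTheory GRing.Theory Num.Theory.
Import numFieldNormedType.Exports.

Local Open Scope classical_set_scope.
Local Open Scope ring_scope.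

Section DisplayAds.
Variables (R : realType) (I J : finType) (T : nat).

Definition arrival_rates (f : 'I_T -> I -> R) : Prop :=
  (forall t i, 0 <= f t i) /\ (forall t, \sum_(i : I) f t i <= 1).

Definition matching_lp_feasible (f : 'I_T -> I -> R)
    (x : 'I_T -> I -> J -> R) : Prop :=
  [/\ forall t i, \sum_(j : J) x t i j <= f t i,
      forall (j : J) (S : {set 'I_T * I}),
        \sum_(ti in S) x ti.1 ti.2 j
          <= 1 - \prod_(t < T) (1 - \sum_(i : I | (t, i) \in S) f t i)
    & forall t i j, 0 <= x t i j].

(* The dummy agent is None; a real agent j is Some j. The sequence ord lists
   the agents in the order in which their intervals are placed. *)
Definition agent_interval (ord : seq J) (m : J -> R) (a : option J) :
    interval R :=
  if a is Some j then
    let l := \sum_(k <- take (index j ord) ord) m k in `[l, l + m j[%R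
  else `[\sum_(k <- ord) m k, 1[%R.

Lemma half_gt0 : 0 < 2^-1 :> R. Proof. by rewrite invr_gt0 ltr0n. Qed.

(* Law of the ordered pair (a, b) with eta \in I_a and eta + 1/2 \in I_b. The
   library's uniform probability lives on the closed interval [0, 1/2]; the
   extra endpoint is a null set. *)
Definition type_decomposition (ord : seq J) (m : J -> R)
    (ab : option J * option J) : R :=
  fine (uniform_prob half_gt0
    [set eta : R | eta \in agent_interval ord m ab.1
                /\ eta + 2^-1 \in agent_interval ord m ab.2]).

(* All the randomness of one step: the arrival, if any, with its surrogate
   pair, then the coin choosing the mark and the coin for a uniform selection. *)
Definition step_outcome : finType :=
  (option (I * (option J * option J)) * bool * bool)%type.

Definition step_law (f : 'I_T -> I -> R) (mu : 'I_T -> I -> J -> R)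
    (ord : seq J) (t : 'I_T) (o : step_outcome) : R :=
  let: (arr, _, _) := o in
  (if arr is Some (i, ab) then f t i * type_decomposition ord (mu t i) ab
   else 1 - \sum_(i : I) f t i) * 2^-1 * 2^-1.

(* The entry of m lists, for the steps marked with m so far, in order, whether
   m was selected in that step. *)
Definition socs_state := option J -> seq bool.

Definition socs_init : socs_state := fun=> [::].

Definition two_way_socs (st : socs_state) (j k : option J)
    (mark_coin select_coin : bool) : option J * socs_state :=
  let m := if mark_coin then j else k in
  let m' := if mark_coin then k else j in
  let s := if st m is [:: selected] then (if selected then m' else m)
           else (if select_coin then j else k) in
  (s, fun a => if a == m then rcons (st a) (s == m) else st a).

Definition socs_step (st : socs_state) (o : step_outcome) :
    option (I * option J) * socs_state :=
  let: (arr, mark_coin, select_coin) := o in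
  if arr is Some (i, (j, k)) then
    if j == k then (Some (i, j), st)
    else let: (s, st') := two_way_socs st j k mark_coin select_coin in
         (Some (i, s), st')
  else (None, st).

(* The successive allocations: Some (i, a) when an item of type i is allocated
   to a, None when no item arrives. *)
Fixpoint socs_run (st : socs_state) (os : seq step_outcome) :
    seq (option (I * option J)) :=
  if os is o :: os' then
    let: (r, st') := socs_step st o in r :: socs_run st' os'
  else [::].

Definition socs_prob (f : 'I_T -> I -> R) (mu : 'I_T -> I -> J -> R)
    (ord : seq J) (E : pred (seq (option (I * option J)))) : R :=
  \sum_(os : T.-tuple step_outcome | E (socs_run socs_init os))
    \prod_(t < T) step_law f mu ord t (tnth os t).

Definition unallocated_above (w : I -> J -> R) (j : J) (v : R)
    (rs : seq (option (I * option J))) : bool :=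
  [forall i : I, (v <= w i j) ==> (Some (i, Some j) \notin rs)].

Definition mass_above (f : 'I_T -> I -> R) (mu : 'I_T -> I -> J -> R)
    (w : I -> J -> R) (j : J) (v : R) : R :=
  \sum_(t < T) \sum_(i : I | v <= w i j) f t i * mu t i j.

End DisplayAds.

Definition pos_part (R : realType) (x : R) : R := Num.max x 0.

Definition g_bound (R : realType) (y : R) : R :=
  let z := pos_part (y - 44%:R / 100%:R) in
  Num.min (expR (- y))
    (expR (- y) * (1 + 2^-1 * z) * expR (- (2^-1 * z)) + (1 - y) / 15%:R).

(* Main.v *)
Require Import Defs.
From mathcomp Require Import all_boot all_order all_algebra.
From mathcomp Require Import all_classical all_reals all_analysis.
From mathcomp Require Import ring lra.
Import Order.TTheory GRing.Theory Num.Theory.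
Local Open Scope ring_scope.

(** Fix an agent and call an item relevant if its weight is at least w. Given
    the arrivals, the surrogate types and the marks, the two steps of a
    correlated pair that both offer the agent make it win exactly once, and all
    other selections are independent fair coins. So the agent never wins with
    probability at most the product of (1 - y_t), hence e^-y, minus the weight
    of the event that its first two marks are both relevant.

    Irrelevant marks can spoil this event; the loss is at most their total mass
    (at most 1 - y) times one quarter of the probability of exactly two
    successes in independent trials of total mean at most 1, which is at most
    1/4: in all (1 - y)/16. Without them, a step-by-step comparison with a
    Poisson process bounds the weight by e^-y (1 + Q) e^-(Q + D), where 2Q = y - P,
    P is the mass of relevant one-way types and D = sum y_t^2 / 4. Finally the
    LP constraint for the relevant (t, i) with mu >= 1/2 gives
    P <= 0.44 + 64 D / 7, and the gain D pays for the excess of P over 0.44. *)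

(** * Elementary inequalities for the exponential *)

Section ExponentialBounds.
Variable R : realType.
Implicit Types x y q u F : R.

Lemma expR_ge_pow n x : (0 < n)%N -> 0 <= 1 + x / n%:R ->
  (1 + x / n%:R) ^+ n <= expR x.
Proof.
move=> n_gt0 x_ge; rewrite -[x in expR x](@divfK _ n%:R) ?pnatr_eq0 -?lt0n//.
by rewrite expRM_natr lerXn2r ?nnegrE ?expR_ge0 ?expR_ge1Dx.
Qed.

(** The square [(1 - u/2 - u^2/8)^2] equals [1 - u + u^3/8 + u^4/64]: the quadratic terms cancel. *)
Lemma expRN_ge_1B_sqr u : 0 <= u -> u <= 1 -> 1 - u <= expR (- (u + u ^+ 2 / 4)).
Proof.
move=> u0 u1.
apply: le_trans (@expR_ge_pow 2 _ _ _) => //; nra.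
Qed.

(** The cubic is the truncation of [(1 - x/16)^16], reached by squaring the degree 3 truncations of
    the fourth and eighth powers. These are non-negative for [z <= 1/8], so squaring preserves the
    inequalities. *)
Lemma expRN_ge_cubic x : 0 <= x -> x <= 2 ->
  1 - x + 15 / 32 * x ^+ 2 - 35 / 256 * x ^+ 3 <= expR (- x).
Proof.
move=> x0 x2; apply: le_trans (@expR_ge_pow 16 _ _ _) => //; last by lra.
set z := x / 16; have z0 : 0 <= z by rewrite /z; lra.
have z1 : z <= 1 / 8 by rewrite /z; lra.
have -> : x = 16 * z by rewrite /z; field.
have -> : - (16 * z) / 16 = - z by field.
have A_ge0 : 0 <= 1 - 4 * z + 6 * z ^+ 2 - 4 * z ^+ 3 by nra.
have B_ge0 : 0 <= 1 - 8 * z + 28 * z ^+ 2 - 56 * z ^+ 3 by nra.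
have AP : 1 - 4 * z + 6 * z ^+ 2 - 4 * z ^+ 3 <= (1 - z) ^+ 4.
  have -> : (1 - z) ^+ 4 =
    1 - 4 * z + 6 * z ^+ 2 - 4 * z ^+ 3 + z ^+ 4 by ring.
  by rewrite lerDl exprn_ge0.
have BP : 1 - 8 * z + 28 * z ^+ 2 - 56 * z ^+ 3 <= (1 - z) ^+ 8.
  rewrite (exprM _ 4 2).
  apply: le_trans (_ : (1 - 4 * z + 6 * z ^+ 2 - 4 * z ^+ 3) ^+ 2 <= _); last first.
    by rewrite lerXn2r ?nnegrE// exprn_even_ge0.
  rewrite -subr_ge0.
  have -> : (1 - 4 * z + 6 * z ^+ 2 - 4 * z ^+ 3) ^+ 2 -
     (1 - 8 * z + 28 * z ^+ 2 - 56 * z ^+ 3) =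
     z ^+ 4 * (68 - 48 * z + 16 * z ^+ 2) by ring.
  by apply: mulr_ge0; [exact: exprn_ge0|nra].
rewrite (exprM _ 8 2).
apply: le_trans (_ : (1 - 8 * z + 28 * z ^+ 2 - 56 * z ^+ 3) ^+ 2 <= _); last first.
  by rewrite lerXn2r ?nnegrE// exprn_even_ge0.
rewrite -subr_ge0.
have -> : (1 - 8 * z + 28 * z ^+ 2 - 56 * z ^+ 3) ^+ 2 -
   (1 - 16 * z + 15 / 32 * (16 * z) ^+ 2 - 35 / 256 * (16 * z) ^+ 3) =
   z ^+ 4 * (1680 - 3136 * z + 3136 * z ^+ 2) by field.
by apply: mulr_ge0; [exact: exprn_ge0|nra].
Qed.

Lemma expR_ge_cubic x : 0 <= x ->
  1 + x + 7 / 16 * x ^+ 2 + 7 / 64 * x ^+ 3 <= expR x.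
Proof.
move=> x0; apply: le_trans (@expR_ge_pow 8 _ _ _) => //; last by nra.
have -> : (1 + x / 8) ^+ 8 = 1 + x + 7 / 16 * x ^+ 2 + 7 / 64 * x ^+ 3 +
  (70 * (x/8) ^+ 4 + 56 * (x/8) ^+ 5 + 28 * (x/8) ^+ 6 + 8 * (x/8) ^+ 7
   + (x/8)^+8) by field.
by rewrite lerDl !addr_ge0// ?mulr_ge0// exprn_ge0// divr_ge0.
Qed.

(** The extreme case [q = y/2] of [expRN_ge_1B_mark]. *)
Lemma expRN_ge_1B_half y : 0 <= y -> y <= 1 ->
  1 - y <= expR (- (3 / 2 * y + y ^+ 2 / 4)) * (1 + y / 2).
Proof.
move=> y0 y1; set s := 3 / 2 * y + y ^+ 2 / 4.
have s0 : 0 <= s by rewrite /s; nra.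
have s2 : s <= 7 / 4 by rewrite /s; nra.
case: (leP y (3 / 5)) => hy.
  apply: le_trans (_ : (1 - s + 15 / 32 * s ^+ 2 - 35 / 256 * s ^+ 3) * (1 + y / 2) <= _).
    rewrite -subr_ge0.
    have -> : (1 - s + 15 / 32 * s ^+ 2 - 35 / 256 * s ^+ 3) * (1 + y / 2) - (1 - y) =
      y ^+ 2 * (7 / 128 + y * (599 / (8 * 256) - 525 / (8 * 256) * y - 285 / (8 * 256) * y ^+ 2
        - 175 / (32 * 256) * y ^+ 3 - 35 / (128 * 256) * y ^+ 4)) by rewrite /s; field.
    have y2 : y ^+ 2 <= y by nra.
    have y3 : y ^+ 3 <= y by nra.
    have y4 : y ^+ 4 <= y by nra.
    apply: mulr_ge0; first exact: sqr_ge0.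
    apply: addr_ge0; first by lra.
    by apply: mulr_ge0; [exact: y0|lra].
  by apply: ler_wpM2r; [lra|apply: expRN_ge_cubic => //; lra].
(* For large [y] the fourth power [(1 - s/4)^4] suffices; the affine function is a lower bound for
   [(1 - s/4)^2]. *)
apply: le_trans (_ : (19 / 20 - 13 / 20 * y) ^+ 2 * (1 + y / 2) <= _).
  have w0 : 0 <= y - 3 / 5 by lra.
  have w2 : 0 <= (y - 3 / 5) ^+ 2 by exact: exprn_ge0.
  have w3 : 0 <= (y - 3 / 5) ^+ 3 by exact: exprn_ge0.
  lra.
apply: ler_wpM2r; first by lra.
apply: le_trans (@expR_ge_pow 4 _ _ _) => //; last by lra.
rewrite (exprM _ 2 2).
apply: lerXn2r; rewrite ?nnegrE; [by lra|by exact: sqr_ge0|].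
have y4 : 0 <= y ^+ 4 by exact: exprn_ge0.
have w2 : 0 <= (y - 3 / 4) ^+ 2 * y by rewrite mulr_ge0// sqr_ge0.
have w3 : 0 <= (y - 3 / 4) ^+ 2 by exact: sqr_ge0.
rewrite /s; lra.
Qed.

(** Lowering [q] from [y/2] gains the factor [e^(y/2 - q)], which makes up for the smaller last
    factor because [(1 + (y/2 - q)) (1 + q) >= 1 + y/2]. *)
Lemma expRN_ge_1B_mark y q : 0 <= y -> y <= 1 -> 0 <= q -> 2 * q <= y ->
  1 - y <= expR (- (y + q + y ^+ 2 / 4)) * (1 + q).
Proof.
move=> y0 y1 q0 qy; apply: le_trans (expRN_ge_1B_half _ _ _) _ => //.
have -> : - (y + q + y ^+ 2 / 4) =
    - (3 / 2 * y + y ^+ 2 / 4) + (y / 2 - q) by field.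
rewrite expRD -[leRHS]mulrA ler_pM2l ?expR_gt0//.
apply: le_trans (_ : (1 + (y / 2 - q)) * (1 + q) <= _); first by nra.
by apply: ler_wpM2r; [lra|exact: expR_ge1Dx].
Qed.

(** The exponent is [57/50 (F + 4/7 F^2)]; its constants are matched to [expRN_ge_tangent] for use
    in [two_minus_prod_le]. *)
Lemma expRN_le_1B F : 0 <= F -> F <= 1 / 2 ->
  expR (- (57 / 50 * F + 114 / 175 * F ^+ 2)) <= 1 - F.
Proof.
move=> F0 F2; set s := 57 / 50 * F + 114 / 175 * F ^+ 2.
have s0 : 0 <= s by rewrite /s; nra.
rewrite expRN -[leRHS]invrK lef_pV2 ?posrE ?expR_gt0 ?invr_gt0//; last by lra.
apply: le_trans (expR_ge_cubic _ _) => //.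
rewrite -[leLHS]mul1r ler_pdivrMr; last by lra.
have F2_ge0 : 0 <= F ^+ 2 by exact: sqr_ge0.
have s2 : 129 / 100 * F ^+ 2 + 148 / 100 * F ^+ 3 + 42 / 100 * F ^+ 4 <= s ^+ 2.
  have F3_ge0 : 0 <= F ^+ 3 by exact: exprn_ge0.
  have F4_ge0 : 0 <= F ^+ 4 by exact: exprn_ge0.
  rewrite /s; lra.
have s3 : 148 / 100 * F ^+ 3 + 253 / 100 * F ^+ 4 <= s ^+ 3.
  have F3_ge0 : 0 <= F ^+ 3 by exact: exprn_ge0.
  have F4_ge0 : 0 <= F ^+ 4 by exact: exprn_ge0.
  have F5_ge0 : 0 <= F ^+ 5 by exact: exprn_ge0.
  have F6_ge0 : 0 <= F ^+ 6 by exact: exprn_ge0.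
  rewrite /s; lra.
have G_ge0 : 0 <= 1 - F by lra.
have := ler_wpM2r G_ge0 s2; have := ler_wpM2r G_ge0 s3.
have : 0 <= F * (1 / 2 - F) by apply: mulr_ge0; lra.
have : 0 <= F ^+ 2 * (1 / 2 - F) by apply: mulr_ge0; lra.
have : 0 <= F ^+ 3 * (1 / 2 - F) by apply: mulr_ge0; [exact: exprn_ge0|lra].
have : 0 <= F ^+ 4 * (1 / 2 - F) by apply: mulr_ge0; [exact: exprn_ge0|lra].
rewrite /s; lra.
Qed.

(** Tangent of [e^-x] at [39/50], with the factor [e^(-39/50)] lowered to the rational [25/57]. *)
Lemma expRN_ge_tangent x : 25 / 57 * (89 / 50 - x) <= expR (- x).
Proof.
have c0 : 25 / 57 <= expR (- (39 / 50) : R).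
  have r0 : (0 : R) <= 1 + - (39 / 50) / 8 by lra.
  apply: le_trans (@expR_ge_pow 8 _ isT r0).
  have r2 : 57 / 70 <= (1 + - (39 / 50) / 8 : R) ^+ 2 by lra.
  have r4 : 53 / 80 <= (1 + - (39 / 50) / 8 : R) ^+ 4.
    by rewrite (exprM _ 2 2); set r := _ ^+ 2 in r2 *; nra.
  by rewrite (exprM _ 4 2); set r := _ ^+ 4 in r4 *; nra.
have := expR_ge1Dx (39 / 50 - x).
have -> : expR (- x) = expR (- (39 / 50)) * expR (39 / 50 - x).
  by rewrite -expRD; congr expR; ring.
move=> h.
case: (leP x (89 / 50)) => hx.
  by apply: ler_pM; [lra|lra|exact: c0|lra].
by apply: le_trans (_ : 0 <= _); [lra|rewrite mulr_ge0 ?expR_ge0].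
Qed.

End ExponentialBounds.

(** * Survival weights *)

Section SurvivalWeights.
Variables (R : realType) (K : Type) (y q b : K -> R).
Hypothesis q_ge0 : forall t, 0 <= q t.
Hypothesis q_le : forall t, 2 * q t <= y t.
Hypothesis b_ge0 : forall t, 0 <= b t.
Hypothesis yqb_le1 : forall t, y t + q t + b t <= 1.

(* For a fixed agent, y is the marginal probability of winning a relevant item
   in a step, q half the probability of a relevant two-way item marked with the
   agent, and b the probability of an irrelevant two-way item marked with it.
   The weights are the probabilities of winning nothing over the steps s: when
   the agent has no correlation left (settled); when it lost a relevant item at
   its first mark, so that a relevant second mark wins (armed); when it has not
   marked a step yet (fresh). *)
Definition settled_weight (s : seq K) : R := \prod_(t <- s) (1 - y t).

(** An armed agent wins at every relevant own mark instead of at half of them, hence the additional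
    loss [q]. The rate [c] of irrelevant marks is a parameter so that the true weights, [c = b], can
    be compared with the unspoiled ones, [c = 0]. *)
Fixpoint armed_weight (c : K -> R) (s : seq K) : R :=
  if s is t :: s' then
    (1 - y t - q t - c t) * armed_weight c s' + c t * settled_weight s'
  else 1.

Fixpoint fresh_weight (c : K -> R) (s : seq K) : R :=
  if s is t :: s' then
    (1 - y t - q t - c t) * fresh_weight c s' + q t * armed_weight c s'
    + c t * settled_weight s'
  else 1.

Let y_ge0 t : 0 <= y t.
Proof. by have := q_ge0 t; have := q_le t; lra. Qed.

Lemma settled_weight_cons t s :
  settled_weight (t :: s) = (1 - y t) * settled_weight s.
Proof. by rewrite /settled_weight big_cons. Qed.

Lemma settled_weight_ge0 s : 0 <= settled_weight s.
Proof.
apply: prodr_ge0 => t _.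
by have := yqb_le1 t; have := q_ge0 t; have := b_ge0 t; lra.
Qed.

Section Monotonicity.
Variable c : K -> R.
Hypothesis c_ge0 : forall t, 0 <= c t.
Hypothesis c_le : forall t, c t <= b t.

Lemma armed_weight_bounds s : 0 <= armed_weight c s <= settled_weight s.
Proof.
elim: s => [|t s /andP[IH0 IH1]]; first by rewrite /settled_weight big_nil/= ler01 lexx.
rewrite settled_weight_cons /=.
have := settled_weight_ge0 s; move: (q_ge0 t) (c_ge0 t) (c_le t) (yqb_le1 t).
set V := settled_weight s in IH1 *; set A := armed_weight c s in IH0 IH1 *.
move=> q0 c0 cb h V0; have k0 : 0 <= 1 - y t - q t - c t by lra.
rewrite addr_ge0 ?mulr_ge0//=.
have := ler_wpM2l k0 IH1; have := mulr_ge0 q0 V0; lra.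
Qed.

Lemma fresh_weight_bounds s : 0 <= fresh_weight c s <= settled_weight s.
Proof.
elim: s => [|t s /andP[IH0 IH1]]; first by rewrite /settled_weight big_nil/= ler01 lexx.
rewrite settled_weight_cons /=.
have := settled_weight_ge0 s; have /andP[] := armed_weight_bounds s.
move: (q_ge0 t) (c_ge0 t) (c_le t) (yqb_le1 t).
set V := settled_weight s in IH1 *; set A := armed_weight c s.
set F := fresh_weight c s in IH0 IH1 *.
move=> q0 c0 cb h A0 AV V0; have k0 : 0 <= 1 - y t - q t - c t by lra.
rewrite !addr_ge0 ?mulr_ge0//=.
have := ler_wpM2l k0 IH1; have := ler_wpM2l q0 AV; lra.
Qed.

End Monotonicity.

Let armed0_bounds := @armed_weight_bounds (fun=> 0) (fun=> lexx _) b_ge0.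
Let fresh0_bounds := @fresh_weight_bounds (fun=> 0) (fun=> lexx _) b_ge0.
Let armed_bounds := @armed_weight_bounds b b_ge0 (fun=> lexx _).
Let fresh_bounds := @fresh_weight_bounds b b_ge0 (fun=> lexx _).

(** An irrelevant mark moves mass from the armed to the settled weight, which is larger. *)
Lemma armed_weight_mono s : armed_weight (fun=> 0) s <= armed_weight b s.
Proof.
elim: s => //= t s IH; have /andP[_ AV] := armed_bounds s.
move: (q_ge0 t) (b_ge0 t) (yqb_le1 t) IH AV.
set V := settled_weight s; set A := armed_weight b s; set A0 := armed_weight _ s.
move=> q0 b0 h IH AV; have k0 : 0 <= 1 - y t - q t by lra.
have := ler_wpM2l k0 IH; have := ler_wpM2l b0 AV; lra.
Qed.

Lemma fresh_weight_mono s : fresh_weight (fun=> 0) s <= fresh_weight b s.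
Proof.
elim: s => //= t s IH; have /andP[_ FV] := fresh_bounds s.
have := armed_weight_mono s; move: (q_ge0 t) (b_ge0 t) (yqb_le1 t) IH FV.
set V := settled_weight s; set A := armed_weight b s; set A0 := armed_weight _ s.
set F := fresh_weight b s; set F0 := fresh_weight _ s.
move=> q0 b0 h IH FV AA; have k0 : 0 <= 1 - y t - q t by lra.
have := ler_wpM2l k0 IH; have := ler_wpM2l b0 FV; have := ler_wpM2l q0 AA; lra.
Qed.

(** * Generating polynomials and the cost of irrelevant marks *)

Definition mark_factor t : {poly R} := (1 - 2 * q t)%:P + (2 * q t) *: 'X.

Lemma coef0_mark_factor t (p : {poly R}) :
  (mark_factor t * p)`_0 = (1 - 2 * q t) * p`_0.
Proof. by rewrite mulrDl coefD coefCM -scalerAl coefZ coefXM mulr0 addr0. Qed.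

Lemma coefS_mark_factor t (p : {poly R}) k :
  (mark_factor t * p)`_k.+1 = (1 - 2 * q t) * p`_k.+1 + 2 * q t * p`_k.
Proof. by rewrite mulrDl coefD coefCM -scalerAl coefZ coefXM. Qed.

Let coef12_mark_factor t (p : {poly R}) :
  (mark_factor t * p)`_1 = (1 - 2 * q t) * p`_1 + 2 * q t * p`_0 /\
  (mark_factor t * p)`_2 = (1 - 2 * q t) * p`_2 + 2 * q t * p`_1.
Proof. by rewrite !coefS_mark_factor. Qed.

(* Generating polynomial of the number of successes in independent trials of
   probabilities 2 q. *)
Definition mark_poly s : {poly R} := \prod_(t <- s) mark_factor t.

Let mark_poly_cons t s : mark_poly (t :: s) = mark_factor t * mark_poly s.
Proof. by rewrite /mark_poly big_cons. Qed.

Let two_q t : 0 <= 1 - 2 * q t.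
Proof. by have := q_le t; have := q_ge0 t; have := b_ge0 t; have := yqb_le1 t; lra. Qed.

Lemma mark_poly_ge0 s k : 0 <= (mark_poly s)`_k.
Proof.
elim: s k => [|t s IH] k; first by rewrite /mark_poly big_nil coef1 ler0n.
rewrite mark_poly_cons; case: k => [|k].
  by rewrite coef0_mark_factor mulr_ge0.
by rewrite coefS_mark_factor addr_ge0 ?mulr_ge0.
Qed.

Lemma mark_poly_coef_sum s :
  (mark_poly s)`_0 + (mark_poly s)`_1 + (mark_poly s)`_2 <= 1.
Proof.
elim: s => [|t s IH]; first by rewrite /mark_poly big_nil !coef1/= !addr0.
rewrite mark_poly_cons coef0_mark_factor.
have [-> ->] := coef12_mark_factor t (mark_poly s).
have := mulr_ge0 (q_ge0 t) (mark_poly_ge0 s 2).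
by move: (mark_poly s)`_0 (mark_poly s)`_1 (mark_poly s)`_2 IH => p0 p1 p2; lra.
Qed.

Lemma mark_poly_coef_mean s :
  (mark_poly s)`_1 + 2 * (mark_poly s)`_2 <= \sum_(t <- s) 2 * q t.
Proof.
elim: s => [|t s IH]; first by rewrite /mark_poly !big_nil !coef1/= mulr0 addr0.
rewrite mark_poly_cons big_cons.
have [-> ->] := coef12_mark_factor t (mark_poly s).
have h : (mark_poly s)`_0 + (mark_poly s)`_1 - 2 * (mark_poly s)`_2 <= 1.
  by have := mark_poly_coef_sum s; have := mark_poly_ge0 s 2; lra.
have := ler_wpM2l (q_ge0 t) h; move: IH.
by move: (\sum_(_ <- s) _) (mark_poly s)`_0 (mark_poly s)`_1 (mark_poly s)`_2 => *; lra.
Qed.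

(** Induction on the trials. For a new trial of probability [2x] and old mean [m], the mean bounds
    the coefficient of degree 1, so the new coefficient is at most [(1 - 6x) p2 + 2xm]. *)
Lemma mark_poly_coef2 s : \sum_(t <- s) 2 * q t <= 1 ->
  (mark_poly s)`_2 <= (\sum_(t <- s) 2 * q t) / 4.
Proof.
elim: s => [|t s IH]; first by rewrite /mark_poly !big_nil !coef1 mul0r.
have := mark_poly_coef_mean s; have := mark_poly_ge0 s 2.
have : 0 <= \sum_(t <- s) 2 * q t by apply: sumr_ge0 => u _; rewrite mulr_ge0.
move: IH; rewrite mark_poly_cons big_cons.
have [_ ->] := coef12_mark_factor t (mark_poly s).
move: (\sum_(t <- s) _) (mark_poly s)`_1 (mark_poly s)`_2 (q_ge0 t) => m p1 p2.
set x := q t => x0 IH m0 p20 h m1; have {}IH : p2 <= m / 4 by apply: IH; lra.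
have : (1 - 2 * x) * p2 + 2 * x * p1 <= (1 - 6 * x) * p2 + 2 * x * m.
  by have := ler_wpM2l x0 h; lra.
move=> /le_trans; apply; have mx0 := mulr_ge0 m0 x0.
(* If [6x > 1] the first term is negative and [2xm <= (2x + m)^2 / 4 <= (2x + m) / 4]; otherwise the
   induction hypothesis applies to [p2]. *)
case: (leP (6 * x) 1) => hx; last first.
  have := mulr_ge0 p20 (_ : 0 <= 6 * x - 1); have := sqr_ge0 (2 * x - m).
  have : 0 <= (2 * x + m) * (1 - (2 * x + m)) by rewrite mulr_ge0//; lra.
  by move=> h1 h2 /(_ ltac:(lra)) h3; lra.
apply: le_trans (_ : (1 - 6 * x) * (m / 4) + 2 * x * m <= _); last first.
  by have := mulr_ge0 x0 (_ : 0 <= 1 - m) => /(_ ltac:(lra)); lra.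
by rewrite lerD2r ler_wpM2l//; lra.
Qed.

Lemma settled_weight_le s : settled_weight s <= (mark_poly s)`_0.
Proof.
elim: s => [|t s IH]; first by rewrite /settled_weight /mark_poly !big_nil coef1.
rewrite settled_weight_cons mark_poly_cons coef0_mark_factor.
rewrite ler_pM ?settled_weight_ge0//; last by have := q_le t; lra.
by have := yqb_le1 t; have := q_ge0 t; have := b_ge0 t; lra.
Qed.

Let keep_le t : 0 <= 1 - y t - q t /\ 1 - y t - q t <= 1 - 2 * q t.
Proof. by have := yqb_le1 t; have := q_ge0 t; have := b_ge0 t; have := q_le t; lra. Qed.

(** The deficit obeys the recursion for exactly one success: a failure has factor
    [1 - y - q <= 1 - 2q], and the success has [q], half of its probability [2q]. For the fresh
    weight two successes give the factor [1/4]. *)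
Lemma armed_deficit_le s :
  settled_weight s - armed_weight (fun=> 0) s <= (mark_poly s)`_1 / 2.
Proof.
elim: s => [|t s IH].
  by rewrite /settled_weight /mark_poly !big_nil coef1/= subrr mul0r.
rewrite settled_weight_cons mark_poly_cons /=.
have [-> _] := coef12_mark_factor t (mark_poly s).
have [k0 k1] := keep_le t; have := settled_weight_le s; have /andP[_] := armed0_bounds s.
move: IH; move: (mark_poly s)`_1 (mark_poly s)`_0 => p1 p0.
set V := settled_weight s; set A := armed_weight _ s => IH AV Vp.
have := ler_wpM2l (q_ge0 t) Vp; have := ler_pM k0 _ k1 IH; rewrite subr_ge0 => /(_ AV); lra.
Qed.

Lemma fresh_deficit_le s :
  settled_weight s - fresh_weight (fun=> 0) s <= (mark_poly s)`_2 / 4.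
Proof.
elim: s => [|t s IH].
  by rewrite /settled_weight /mark_poly !big_nil coef1/= subrr mul0r.
rewrite settled_weight_cons mark_poly_cons /=.
have [_ ->] := coef12_mark_factor t (mark_poly s).
have [k0 k1] := keep_le t; have := armed_deficit_le s; have /andP[_] := fresh0_bounds s.
move: IH; move: (mark_poly s)`_1 (mark_poly s)`_2 => p1 p2.
set V := settled_weight s; set A := armed_weight _ s; set F := fresh_weight _ s.
move=> IH FV Ap.
have := ler_wpM2l (q_ge0 t) Ap; have := ler_pM k0 _ k1 IH; rewrite subr_ge0 => /(_ FV); lra.
Qed.

(* The product rule derivative of mark_poly in which the factor of t is
   replaced by b t. *)
Fixpoint spoil_poly s : {poly R} :=
  if s is t :: s' then b t *: mark_poly s' + mark_factor t * spoil_poly s'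
  else 0.

Lemma spoil_poly_ge0 s k : 0 <= (spoil_poly s)`_k.
Proof.
elim: s k => [|t s IH] k /=; first by rewrite coef0.
rewrite coefD coefZ addr_ge0 ?mulr_ge0 ?mark_poly_ge0//.
case: k => [|k]; first by rewrite coef0_mark_factor mulr_ge0.
by rewrite coefS_mark_factor addr_ge0 ?mulr_ge0.
Qed.

(** Each summand of the derivative is [b t] times the polynomial of the other trials, whose mean is
    still at most 1, so [mark_poly_coef2] applies. The list [r] holds the trials already passed in
    the induction. *)
Lemma spoil_poly_coef2 r s : \sum_(t <- r ++ s) 2 * q t <= 1 ->
  (mark_poly r * spoil_poly s)`_2 <= (\sum_(t <- s) b t) / 4.
Proof.
elim: s r => [|t s IH] r; first by rewrite /= mulr0 coef0 big_nil mul0r.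
rewrite /= !big_cat !big_cons/= => h.
have -> : mark_poly r * (b t *: mark_poly s + mark_factor t * spoil_poly s) =
    b t *: mark_poly (r ++ s) + mark_poly (t :: r) * spoil_poly s.
  by rewrite /mark_poly big_cat big_cons /= mulrDr scalerAr mulrA [_ * mark_factor t]mulrC.
rewrite coefD coefZ mulrDl lerD//; last first.
  by apply: IH; rewrite /= big_cons big_cat/=; lra.
rewrite ler_wpM2l//.
have rs1 : \sum_(u <- r ++ s) 2 * q u <= 1.
  by rewrite big_cat/=; have := q_ge0 t; lra.
by have := mark_poly_coef2 _ rs1; lra.
Qed.

(** A spoiled step adds [b t] times the later deficit, which the unspoiled deficit dominates; this
    is the recursion of [spoil_poly]. *)
Lemma armed_spoil_le s :
  armed_weight b s - armed_weight (fun=> 0) s <= (spoil_poly s)`_1 / 2.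
Proof.
elim: s => [|t s IH] /=; first by rewrite subrr coef0 mul0r.
rewrite coefD coefZ.
have [-> _] := coef12_mark_factor t (spoil_poly s).
have [k0 k1] := keep_le t; have := armed_deficit_le s; have := armed_weight_mono s.
have := mulr_ge0 (q_ge0 t) (spoil_poly_ge0 s 0).
move: IH; move: (mark_poly s)`_1 (spoil_poly s)`_1 (spoil_poly s)`_0 => p1 s1 s0.
set V := settled_weight s; set A := armed_weight b s; set A0 := armed_weight _ s.
move=> IH qs AA Ap; have AA' : V - A <= p1 / 2 by lra.
have := ler_wpM2l (b_ge0 t) AA'; have := ler_pM k0 _ k1 IH; rewrite subr_ge0 => /(_ AA); lra.
Qed.

Lemma fresh_spoil_le s :
  fresh_weight b s - fresh_weight (fun=> 0) s <= (spoil_poly s)`_2 / 4.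
Proof.
elim: s => [|t s IH] /=; first by rewrite subrr coef0 mul0r.
rewrite coefD coefZ.
have [_ ->] := coef12_mark_factor t (spoil_poly s).
have [k0 k1] := keep_le t; have := fresh_deficit_le s; have := fresh_weight_mono s.
have := armed_spoil_le s.
move: IH; move: (mark_poly s)`_2 (spoil_poly s)`_2 (spoil_poly s)`_1 => p2 s2 s1.
set V := settled_weight s; set A := armed_weight b s; set A0 := armed_weight _ s.
set F := fresh_weight b s; set F0 := fresh_weight _ s.
move=> IH As FF Fp; have FF' : V - F <= p2 / 4 by lra.
have := ler_wpM2l (b_ge0 t) FF'; have := ler_wpM2l (q_ge0 t) As.
have := ler_pM k0 _ k1 IH; rewrite subr_ge0 => /(_ FF); lra.
Qed.

Lemma fresh_weight_le_unspoiled s : \sum_(t <- s) 2 * q t <= 1 ->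
  fresh_weight b s <= fresh_weight (fun=> 0) s + (\sum_(t <- s) b t) / 16.
Proof.
move=> /(spoil_poly_coef2 [::]).
rewrite /mark_poly big_nil mul1r; have := fresh_spoil_le s; lra.
Qed.

(** * Comparison of the weights with exponentials *)

Lemma settled_weight_expR s : settled_weight s <= expR (- \sum_(t <- s) y t).
Proof.
elim: s => [|t s IH]; first by rewrite /settled_weight !big_nil oppr0 expR0.
rewrite settled_weight_cons big_cons opprD expRD ler_pM ?settled_weight_ge0//.
  by have := yqb_le1 t; have := q_ge0 t; have := b_ge0 t; lra.
by have := expR_ge1Dx (- y t); lra.
Qed.

(** The factor [(1 + Q) e^-Q] is the probability of at most one point of a Poisson variable of mean
    [Q]. The armed weight, comparable to no point at all, is carried along in the induction. *)
Lemma fresh_weight_expR s :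
  fresh_weight (fun=> 0) s <=
  expR (- \sum_(t <- s) (y t + q t + y t ^+ 2 / 4)) * (1 + \sum_(t <- s) q t).
Proof.
suff /andP[_ //] : (armed_weight (fun=> 0) s <=
    expR (- \sum_(t <- s) (y t + q t + y t ^+ 2 / 4))) && (fresh_weight (fun=> 0) s <=
  expR (- \sum_(t <- s) (y t + q t + y t ^+ 2 / 4)) * (1 + \sum_(t <- s) q t)).
elim: s => [|t s /andP[IHA IHF]] /=; first by rewrite !big_nil oppr0 expR0 addr0 mulr1 lexx.
rewrite !big_cons opprD expRD.
have Q0 : 0 <= \sum_(t <- s) q t by apply: sumr_ge0.
move: IHA IHF Q0; set E := expR (- \sum_(t <- s) _); set e := expR _.
move: (\sum_(t <- s) q t) => Q; have E0 : 0 <= E by exact: expR_ge0.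
set A := armed_weight _ s; set F := fresh_weight _ s => AE FE Q0.
move: (q_ge0 t) (y_ge0 t) (q_le t) (yqb_le1 t) (b_ge0 t) => q0 y0 qy h b0.
have k0 : 0 <= 1 - y t - q t by lra.
have ke : 1 - y t - q t <= e.
  apply: le_trans (_ : 1 - (y t + q t) <= _); first by lra.
  apply: le_trans (expRN_ge_1B_sqr _ _ _ _) _; [lra|lra|rewrite ler_expR; nra].
have kqe : 1 - y t <= e * (1 + q t) by apply: expRN_ge_1B_mark; lra.
rewrite subr0 mul0r addr0; apply/andP; split.
  apply: le_trans (ler_wpM2l k0 AE) _; exact: ler_wpM2r.
have := ler_wpM2l k0 FE; have := ler_wpM2l q0 AE.
(* With [k = 1 - y t - q t], the left factor is [(k + q t) + k Q]; [kqe] bounds the first summand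
   and [ke] the second. *)
have : ((1 - y t - q t) * (1 + Q) + q t) * E <= e * (1 + q t + Q) * E.
  by apply: ler_wpM2r => //; have := ler_wpM2r Q0 ke; lra.
lra.
Qed.

End SurvivalWeights.

(** * From the survival weights to the function [g] *)

Section GBound.
Variable R : realType.

Lemma prod_1B_ge (K : Type) (F : K -> R) (s : seq K) :
  (forall t, 0 <= F t) -> (forall t, F t <= 1) ->
  1 - \sum_(t <- s) F t <= \prod_(t <- s) (1 - F t).
Proof.
move=> F0 F1; elim: s => [|t s IH]; first by rewrite !big_nil subr0.
rewrite !big_cons; have S0 : 0 <= \sum_(t <- s) F t by apply: sumr_ge0.
have G0 : 0 <= 1 - F t by have := F1 t; lra.
by have := ler_wpM2l G0 IH; have := mulr_ge0 (F0 t) S0; lra.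
Qed.

(** If some [F t] exceeds [1/2], it is split off and the other factors are bounded by Weierstrass's
    product inequality [prod_1B_ge]. Otherwise every factor has the exponential bound
    [expRN_le_1B]. *)
Lemma two_minus_prod_le (K : eqType) (F : K -> R) (s : seq K) :
  (forall t, 0 <= F t) -> (forall t, F t <= 1) ->
  2 - 2 * \prod_(t <- s) (1 - F t) - \sum_(t <- s) F t
    <= 11 / 25 + 4 / 7 * \sum_(t <- s) F t ^+ 2.
Proof.
move=> F0 F1.
have S20 r : 0 <= \sum_(t <- r) F t ^+ 2.
  by apply: sumr_ge0 => u _; exact: sqr_ge0.
case: (boolP (has (fun t => 1 / 2 < F t) s)) => [/hasP[t ts ht]|/hasPn hs].
  rewrite !(big_rem t ts)/=.
  have S0 : 0 <= \sum_(t <- rem t s) F t by apply: sumr_ge0.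
  have := prod_1B_ge _ _ (rem t s) F0 F1; have := S20 (rem t s).
  move: (\prod_(_ <- _) _) (\sum_(_ <- _) _ ^+ 2) (\sum_(_ <- _) _) S0 (F1 t) ht.
  move: (F t) => x p v S S0 x1 hx v0 hp; have x10 : 0 <= 1 - x by lra.
  have h2x : 0 <= 2 * x - 1 by lra.
  have := ler_wpM2l x10 hp; have := mulr_ge0 S0 h2x.
  (* What remains is [x <= 11/25 + 4/7 x^2]. The minimum of [4/7 x^2 - x], at [x = 7/8], is [-7/16],
     above [-11/25]. *)
  by have := sqr_ge0 (x - 7 / 8); lra.
have hP : expR (- \sum_(t <- s) (57 / 50 * F t + 114 / 175 * F t ^+ 2)) <=
    \prod_(t <- s) (1 - F t).
  elim: s hs => [|t s IH] hs; first by rewrite !big_nil oppr0 expR0.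
  rewrite !big_cons opprD expRD ler_pM ?expR_ge0//.
    by apply: expRN_le_1B => //; rewrite leNgt hs// mem_head.
  by apply: IH => u us; apply: hs; rewrite inE us orbT.
move: hP; rewrite big_split/= -!mulr_sumr.
move: (\prod_(_ <- _) _) (\sum_(_ <- s) _ ^+ 2) (S20 s) (\sum_(_ <- s) _) => p v v0 S.
(* Since [2 * 25/57 * 57/50 = 1], the sum [S] cancels. The constant left is [2 - 89/57 = 25/57],
   just below [11/25]. *)
have := expRN_ge_tangent R (57 / 50 * S + 114 / 175 * v).
by move=> /le_trans/[apply]; lra.
Qed.

(** As [(1 + x) e^-x] decreases for [x >= 0], the gain [D] is needed only when [Q] falls short of
    [z/2]; then the last hypothesis makes [D] at least [7/32] of the shortfall. *)
Lemma expR_gain_le (Y Q D : R) : Y <= 1 -> 0 <= Q -> 0 <= D ->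
  Y - 2 * Q <= 11 / 25 + 64 / 7 * D ->
  expR (- (Q + D)) * (1 + Q) <=
  (1 + 2^-1 * pos_part (Y - 44%:R / 100%:R))
    * expR (- (2^-1 * pos_part (Y - 44%:R / 100%:R))).
Proof.
move=> Y1 Q0 D0 h; set z := pos_part _.
have z0 : 0 <= z by rewrite /z /pos_part le_max lexx orbT.
suff hx : 1 + Q <= (1 + 2^-1 * z) * expR (Q + D - 2^-1 * z).
  apply: le_trans (ler_wpM2l (expR_ge0 _) hx) _.
  by rewrite mulrCA -expRD [X in expR X](_ : _ = - (2^-1 * z))//; ring.
have w0 : 0 <= 1 + 2^-1 * z by lra.
apply: le_trans (ler_wpM2l w0 (expR_ge1Dx _)).
case: (leP z (2 * Q)) => hQ.
  by have := mulr_ge0 z0 (_ : 0 <= Q - 2^-1 * z); have := mulr_ge0 z0 D0;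
    move=> + /(_ ltac:(lra)); lra.
have zE : z = Y - 11 / 25.
  move: hQ; rewrite /z /pos_part; case: (leP (Y - 44%:R / 100%:R) 0) => ? ?; lra.
have d0 : 0 <= 2^-1 * z - Q by lra.
(* Since [Y <= 1], [z/2] is at most [(1 - 11/25) / 2 = 7/25], exactly the threshold up to which
   [7/32 (1 + z/2) >= z/2]. *)
have z1 : 0 <= 7 / 25 - 2^-1 * z by lra.
have hD : 0 <= D - 7 / 32 * (2^-1 * z - Q) by lra.
by have := mulr_ge0 d0 z1; have := mulr_ge0 w0 hD; lra.
Qed.

(** In the application [F t] is the arrival probability of the relevant types with [mu >= 1/2], and
    [X t] their mass allocated to the agent; [2 X t - F t] is then the relevant one-way mass. *)
Lemma fresh_weight_le_g (K : eqType) (y q b F X : K -> R) (s : seq K) :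
  (forall t, 0 <= q t) -> (forall t, 2 * q t <= y t) ->
  (forall t, 0 <= b t) -> (forall t, y t + q t + b t <= 1) ->
  (forall t, 0 <= F t) -> (forall t, F t <= 1) ->
  (forall t, F t <= 2 * X t) -> (forall t, X t <= y t) ->
  (forall t, y t - 2 * q t <= 2 * X t - F t) ->
  \sum_(t <- s) X t <= 1 - \prod_(t <- s) (1 - F t) ->
  \sum_(t <- s) y t + \sum_(t <- s) b t <= 1 ->
  fresh_weight R K y q b s <= g_bound (\sum_(t <- s) y t).
Proof.
move=> q0 qy b0 yqb F0 F1 FX Xy pX LP yb.
rewrite /g_bound le_min; apply/andP; split.
  apply: le_trans (settled_weight_expR _ _ _ _ _ q0 b0 yqb s).
  by have /andP[] := fresh_weight_bounds _ _ _ _ _ q0 b0 yqb _ b0 (fun=> lexx _) s.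
set Y := \sum_(t <- s) y t in yb *; set z := pos_part _.
have B0 : 0 <= \sum_(t <- s) b t by apply: sumr_ge0.
have Q0 : 0 <= \sum_(t <- s) q t by apply: sumr_ge0.
have QY : 2 * \sum_(t <- s) q t <= Y by rewrite mulr_sumr ler_sum.
have Q1 : \sum_(t <- s) 2 * q t <= 1 by rewrite -mulr_sumr; lra.
apply: le_trans (fresh_weight_le_unspoiled _ _ _ _ _ q0 qy b0 yqb s Q1) _.
apply: lerD; last by move: yb B0; rewrite -/Y; move: (\sum_(_ <- s) b _) => B *; lra.
apply: le_trans (fresh_weight_expR _ _ _ _ _ q0 qy b0 yqb s) _.
set D := \sum_(t <- s) (y t ^+ 2 / 4).
rewrite big_split/= big_split/= -/Y -/D -addrA opprD expRD -!mulrA.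
apply: ler_wpM2l; first exact: expR_ge0.
have D0 : 0 <= D by apply: sumr_ge0 => t _; rewrite divr_ge0// sqr_ge0.
apply: expR_gain_le => //; first by lra.
(* From [F <= 2X <= 2y] follows [F^2 <= 16 (y^2 / 4)], and [16 * 4/7 = 64/7]. *)
have VD : 4 / 7 * \sum_(t <- s) F t ^+ 2 <= 64 / 7 * D.
  rewrite /D !mulr_sumr; apply: ler_sum => t _.
  suff : F t ^+ 2 <= (2 * y t) ^+ 2 by lra.
  by rewrite lerXn2r ?nnegrE//; have := F0 t; have := FX t; have := Xy t; lra.
have P_le : Y - 2 * \sum_(t <- s) q t <= 2 * \sum_(t <- s) X t - \sum_(t <- s) F t.
  by rewrite /Y !mulr_sumr -!sumrB ler_sum.
by have := two_minus_prod_le _ F s F0 F1; lra.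
Qed.

End GBound.

(** * The run of the algorithm seen from one agent *)

Section RunWeight.
Variables (R : realType) (I J : finType) (j : J) (good : pred I).

Definition misses (r : option (I * option J)) : bool :=
  if r is Some (i, a) then ~~ (good i && (a == Some j)) else true.

(** The probability of missing throughout, as a recursion on the state instead of a sum over whole
    runs. *)
Fixpoint run_weight (K : Type) (law : K -> step_outcome I J -> R) (s : seq K)
    (st : socs_state J) : R :=
  if s is t :: s' then
    \sum_o law t o * (if misses (socs_step st o).1
                      then run_weight K law s' (socs_step st o).2 else 0)
  else 1.

Lemma run_weight_map (K L : Type) (h : K -> L) (law : L -> step_outcome I J -> R)
    (s : seq K) st :
  run_weight L law [seq h t | t <- s] st = run_weight K (fun t => law (h t)) s st.
Proof.
by elim: s st => //= t s IH st; apply: eq_bigr => o _; rewrite IH.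
Qed.

Lemma sum_tupleS (A : finType) (n : nat) (F : n.+1.-tuple A -> R) :
  \sum_(u : n.+1.-tuple A) F u = \sum_(a : A) \sum_(u : n.-tuple A) F [tuple of a :: u].
Proof.
rewrite pair_bigA /=.
rewrite (reindex (fun p : A * n.-tuple A => [tuple of p.1 :: p.2]))//.
exists (fun u => (thead u, [tuple of behead u])) => [[a u] _|u _] /=.
  by congr pair; apply: val_inj.
by rewrite [RHS]tuple_eta; apply: val_inj.
Qed.

Lemma sum_run_weight (n : nat) (law : 'I_n -> step_outcome I J -> R) st :
  \sum_(os : n.-tuple (step_outcome I J) | all misses (socs_run st os))
    \prod_(t < n) law t (tnth os t) = run_weight 'I_n law (enum 'I_n) st.
Proof.
elim: n law st => [|n IH] law st.
  have -> : enum 'I_0 = [::] by apply: size0nil; rewrite size_enum_ord.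
  rewrite (big_pred1 [tuple]) ?big_ord0// => u.
  by rewrite tuple0 /= eqxx.
rewrite big_mkcond sum_tupleS enum_ordSl /=; apply: eq_bigr => o _.
rewrite run_weight_map -IH.
case: (socs_step st o) => r st' /=.
case: (misses r) => /=; last by rewrite big1// mulr0.
rewrite mulr_sumr [RHS]big_mkcond/=; apply: eq_bigr => u _.
case: ifP => // _; rewrite big_ord_recl tnth0; congr (_ * _).
by apply: eq_bigr => t _; rewrite tnthS.
Qed.

(* What the state retains about an agent: how often it marked a step, and
   whether it was selected at its only mark. Blurred stands for a single mark
   whose outcome is a fair coin independent of everything observed so far, so
   that it can be drawn at the second mark. *)
Inductive mark := Unmarked | Once of bool | Blurred | Often.

Definition marks := option J -> mark.

Definition mark_of (s : seq bool) : mark :=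
  match s with [::] => Unmarked | [:: x] => Once x | _ => Often end.

Definition set_mark (c : marks) (m : option J) (v : mark) : marks :=
  fun a => if a == m then v else c a.

Lemma set_markE c m v : set_mark c m v m = v.
Proof. by rewrite /set_mark eqxx. Qed.

Lemma set_mark_neq c m v a : a != m -> set_mark c m v a = c a.
Proof. by rewrite /set_mark => /negbTE ->. Qed.

Lemma set_markK c m u v : set_mark (set_mark c m u) m v = set_mark c m v.
Proof. by apply: funext => a; rewrite /set_mark; case: eqP. Qed.

Lemma set_markC c m n u v : m != n ->
  set_mark (set_mark c m u) n v = set_mark (set_mark c n v) m u.
Proof.
move=> mn; apply: funext => a; rewrite /set_mark.
by case: eqP => // ->; rewrite eq_sym (negbTE mn).
Qed.

(* Average of G over the selection made in a step marked with m, the other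
   candidate being m'. *)
Definition marked_value (G : option J -> marks -> R) (c : marks)
    (m m' : option J) : R :=
  match c m with
  | Unmarked => (G m (set_mark c m (Once true))
                 + G m' (set_mark c m (Once false))) / 2
  | Once x => G (if x then m' else m) (set_mark c m Often)
  | _ => (G m (set_mark c m Often) + G m' (set_mark c m Often)) / 2
  end.

Definition miss_value (W : marks -> R) (i : I) (a : option J) (c : marks) : R :=
  if good i && (a == Some j) then 0 else W c.

Definition arrival_value (W : marks -> R) (c : marks)
    (arr : option (I * (option J * option J))) : R :=
  if arr is Some (i, (x, k)) then
    if x == k then miss_value W i x c
    else (marked_value (miss_value W i) c x k
          + marked_value (miss_value W i) c k x) / 2
  else W c.

Fixpoint mark_weight (K : Type)
    (law : K -> option (I * (option J * option J)) -> R) (s : seq K) : marks -> R :=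
  if s is t :: s' then
    fun c => \sum_arr law t arr * arrival_value (mark_weight K law s') c arr
  else fun=> 1.

Lemma sum_step_outcome (F : step_outcome I J -> R) :
  \sum_o F o = \sum_arr (F (arr, true, true) + F (arr, true, false)
                         + (F (arr, false, true) + F (arr, false, false))).
Proof.
have -> : \sum_o F o = \sum_u \sum_(sc : bool) F (u, sc).
  by rewrite pair_bigA; apply: eq_bigr => -[].
transitivity (\sum_arr \sum_(mc : bool) \sum_(sc : bool) F (arr, mc, sc)).
  by rewrite [RHS]pair_bigA; apply: eq_bigr => -[].
by apply: eq_bigr => arr _; rewrite !big_bool.
Qed.

(** The algorithm reads a history only when it has length one, so [mark_of] keeps all that matters,
    and averaging over the two coins gives [arrival_value]. *)
Lemma run_weight_mark (K : Type) (law : K -> option (I * (option J * option J)) -> R)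
    (s : seq K) st :
  run_weight K (fun t o => law t o.1.1 * 2^-1 * 2^-1) s st
    = mark_weight K law s (fun a => mark_of (st a)).
Proof.
elim: s st => //= t s IH st.
rewrite sum_step_outcome; apply: eq_bigr => -[[i [x k]]|] _ /=; last by rewrite IH; field.
have [->|xk] := eqVneq x k => /=.
  by rewrite /miss_value IH; case: (good i && _) => /=; field.
have update m r : (fun a => mark_of (if a == m then rcons (st a) r else st a)) =
    set_mark (fun a => mark_of (st a)) m (if st m is [::] then Once r else Often).
  apply: funext => a; rewrite /set_mark; case: eqP => // ->.
  by case: (st m) => [|? []].
rewrite !IH !update /marked_value /miss_value.
have [kx kk xx] : [/\ (k == x) = false, (k == k) = true & (x == x) = true].
  by rewrite eq_sym (negbTE xk) !eqxx.
case: (st x) => [|[] [|? ?]] /=; case: (st k) => [|[] [|? ?]] /=;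
rewrite ?kx ?kk ?xx ?(negbTE xk);
case: (good i && (x == Some j)); case: (good i && (k == Some j)) => /=;
by field.
Qed.

Lemma mark_weight_blur (K : Type) law (s : seq K) c m :
  mark_weight K law s (set_mark c m Blurred) =
  (mark_weight K law s (set_mark c m (Once true))
   + mark_weight K law s (set_mark c m (Once false))) / 2.
Proof.
elim: s c => [|t s IH] c /=; first by field.
rewrite -big_split/= mulr_suml; apply: eq_bigr => arr _.
rewrite -mulrDr -mulrA; congr (_ * _).
case: arr => [[i [x k]]|] /=; last exact: IH.
set G := miss_value _ i.
have GB a d : G a (set_mark d m Blurred) =
    (G a (set_mark d m (Once true)) + G a (set_mark d m (Once false))) / 2.
  by rewrite /G /miss_value; case: ifP => _; [rewrite addr0 mul0r|exact: IH].
have pairB n n' : marked_value G (set_mark c m Blurred) n n' =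
    (marked_value G (set_mark c m (Once true)) n n'
     + marked_value G (set_mark c m (Once false)) n n') / 2.
  rewrite /marked_value; have [->|nm] := eqVneq n m.
    (* At the second mark, [Once true] selects [n'] and [Once false] selects [n]: their average is
       the fair coin of [Blurred]. *)
    by rewrite !set_markE !set_markK addrC.
  rewrite !set_mark_neq//; move: (nm); rewrite eq_sym => mn.
  by case: (c n) => [|[]||]; rewrite !(set_markC _ _ _ _ _ mn) !GB//; field.
by case: ifP => _; [exact: GB|rewrite !pairB; field].
Qed.

(** * Bounds for a single arrival *)

Definition involves (x k : option J) : bool :=
  (x != k) && ((x == Some j) || (k == Some j)).

Definition wins (arr : option (I * (option J * option J))) : bool :=
  if arr is Some (i, (x, k)) then [&& good i, x == Some j & k == Some j] else false.

Definition contested (arr : option (I * (option J * option J))) : bool :=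
  if arr is Some (i, (x, k)) then good i && involves x k else false.

Definition distracting (arr : option (I * (option J * option J))) : bool :=
  if arr is Some (i, (x, k)) then ~~ good i && involves x k else false.

Section ArrivalBound.
Variables (W : marks -> R) (fresh armed settled : R).
Hypothesis W_blur : forall c m, W (set_mark c m Blurred) =
  (W (set_mark c m (Once true)) + W (set_mark c m (Once false))) / 2.

Definition mark_bound (v : mark) : R :=
  match v with Unmarked => fresh | Once _ => armed | _ => settled end.

(** Twice the bound for a relevant step marked with the agent: at most the losing half of the coin
    survives, and after a lost first mark nothing does. *)
Definition own_mark_bound (v : mark) : R :=
  match v with Unmarked => armed | Once _ => 0 | _ => settled end.

(* As long as the agent has won nothing relevant, it was not selected at its
   own relevant marks, and any other agent was selected at a mark shared with
   it; all other single marks can be blurred. *)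
Definition losing (c : marks) : Prop := forall m, c m <> Once (m == Some j).

Hypothesis W_le : forall c, losing c -> W c <= mark_bound (c (Some j)).
Hypothesis fresh_ge0 : 0 <= fresh.
Hypothesis armed_ge0 : 0 <= armed.
Hypothesis settled_ge0 : 0 <= settled.

Let mark_bound_ge0 v : 0 <= mark_bound v. Proof. by case: v. Qed.

Lemma losing_set_mark c m v : losing c -> v <> Once (m == Some j) ->
  losing (set_mark c m v).
Proof. by move=> lc hv a; rewrite /set_mark; case: eqP => [->|_]. Qed.

Section Marked.
Variables (c : marks) (i : I).
Hypothesis losing_c : losing c.

Let W_set_other m v : m != Some j -> v <> Once (m == Some j) ->
  W (set_mark c m v) <= mark_bound (c (Some j)).
Proof.
move=> mj hv; apply: le_trans (W_le _ (losing_set_mark _ _ _ losing_c hv)) _.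
by rewrite set_mark_neq// eq_sym.
Qed.

Let W_set_own v : v <> Once true -> W (set_mark c (Some j) v) <= mark_bound v.
Proof.
move=> hv; apply: le_trans (W_le _ (losing_set_mark _ _ _ losing_c _)) _.
  by rewrite eqxx.
by rewrite set_markE.
Qed.

(** Averaging over the outcome of a first mark of [m] produces [Blurred], which preserves [losing]
    and leaves the mark of the agent itself unchanged. *)
Lemma marked_value_uninvolved m m' : m != Some j ->
  ~~ (good i && (m' == Some j)) ->
  marked_value (miss_value W i) c m m' <= mark_bound (c (Some j)).
Proof.
move=> mj /negbTE m'j.
have missE a d : a \in [:: m; m'] -> miss_value W i a d = W d.
  rewrite /miss_value !inE => /orP[]/eqP->; first by rewrite (negbTE mj) andbF.
  by rewrite m'j.
rewrite /marked_value; case: (c m) => [|x||].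
- by rewrite !missE ?inE ?eqxx ?orbT// -W_blur W_set_other.
- by rewrite missE ?W_set_other// !inE; case: x; rewrite eqxx ?orbT.
- rewrite !missE ?inE ?eqxx ?orbT// -mulr2n -[X in X / _]mulr_natr mulfK ?pnatr_eq0//.
  by rewrite W_set_other.
- rewrite !missE ?inE ?eqxx ?orbT// -mulr2n -[X in X / _]mulr_natr mulfK ?pnatr_eq0//.
  by rewrite W_set_other.
Qed.

(** An irrelevant own mark uses up the correlation: the mark turns [Blurred] or [Often], both
    bounded by [settled]. *)
Lemma marked_value_own_bad m' : ~~ good i ->
  marked_value (miss_value W i) c (Some j) m' <= settled.
Proof.
move=> /negbTE bad; rewrite /marked_value /miss_value bad /=.
have hO : W (set_mark c (Some j) Often) <= settled by exact: (W_set_own Often).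
have hB : W (set_mark c (Some j) Blurred) <= settled by exact: (W_set_own Blurred).
by case: (c (Some j)) => [|x||]; rewrite -?W_blur//; lra.
Qed.

Lemma marked_value_own_good m' : good i -> m' != Some j ->
  marked_value (miss_value W i) c (Some j) m' <= own_mark_bound (c (Some j)) / 2.
Proof.
move=> gi /negbTE m'j; rewrite /marked_value /miss_value gi /= eqxx m'j.
have hO : W (set_mark c (Some j) Often) <= settled by exact: (W_set_own Often).
have hA : W (set_mark c (Some j) (Once false)) <= armed by exact: (W_set_own (Once false)).
case E : (c (Some j)) => [|x||] /=; [lra| |lra|lra].
(* The invariant [losing] excludes [Once true]; after [Once false] the agent is selected and
   wins. *)
case: x E => E; last by rewrite eqxx; lra.
by have := losing_c (Some j); rewrite E eqxx.
Qed.

(** When the agent survives, the rival is selected, so a first mark becomes [Once true], as [losing]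
    requires. A rival already in that state is now passed over, and the agent wins. *)
Lemma marked_value_rival_good m : good i -> m != Some j ->
  marked_value (miss_value W i) c m (Some j) <= mark_bound (c (Some j)) / 2.
Proof.
move=> gi mj; rewrite /marked_value /miss_value gi /= eqxx (negbTE mj).
have hO := W_set_other m Often mj (fun e => ltac:(discriminate e)).
have hT : W (set_mark c m (Once true)) <= mark_bound (c (Some j)).
  by apply: W_set_other => //; rewrite (negbTE mj).
have B0 := mark_bound_ge0 (c (Some j)).
case E : (c m) => [|x||] /=; [lra| |lra|lra].
case: x E => E; first by rewrite eqxx; lra.
by have := losing_c m; rewrite E (negbTE mj).
Qed.

End Marked.

Lemma arrival_value_le c arr : losing c ->
  arrival_value W c arr <=
    if wins arr then 0
    else if contested arr then
      (mark_bound (c (Some j)) + own_mark_bound (c (Some j))) / 4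
    else if distracting arr then (mark_bound (c (Some j)) + settled) / 2
    else mark_bound (c (Some j)).
Proof.
move=> lc; case: arr => [[i [x k]]|] /=; last exact: W_le.
rewrite /involves; have [<-|xk] /= := eqVneq x k.
  rewrite !andbF andbb /miss_value.
  by case: ifP => // _; exact: W_le.
have B0 := mark_bound_ge0 (c (Some j)).
have [xj|xj] /= := eqVneq x (Some j); have [kj|kj] /= := eqVneq k (Some j).
- by move: xk; rewrite xj kj eqxx.
- rewrite andbF xj !andbT; case: ifP => [gi|/negbT bi] /=.
    have := marked_value_own_good c i lc k gi kj.
    have := marked_value_rival_good c i lc k gi kj; lra.
  have := marked_value_own_bad c i lc k bi.
  have := marked_value_uninvolved c i lc k (Some j) kj; rewrite negb_and bi => /(_ isT).
  by lra.
- rewrite andbF kj !andbT; case: ifP => [gi|/negbT bi] /=.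
    have := marked_value_own_good c i lc x gi xj.
    have := marked_value_rival_good c i lc x gi xj; lra.
  have := marked_value_own_bad c i lc x bi.
  have := marked_value_uninvolved c i lc x (Some j) xj; rewrite negb_and bi => /(_ isT).
  by lra.
- rewrite !andbF.
  have := marked_value_uninvolved c i lc x k xj; rewrite (negbTE kj) andbF => /(_ isT).
  have := marked_value_uninvolved c i lc k x kj; rewrite (negbTE xj) andbF => /(_ isT).
  by lra.
Qed.

End ArrivalBound.

(** * Induction over the steps *)

Section MarkWeightBound.
Variables (K : Type) (law : K -> option (I * (option J * option J)) -> R).
Hypothesis law_ge0 : forall t arr, 0 <= law t arr.
Hypothesis law_le1 : forall t, \sum_arr law t arr <= 1.

(** One factor [1/2] is for the mark falling on the agent, the other for the halving in the
    definition of [q]. *)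
Definition contested_rate t := (\sum_(arr | contested arr) law t arr) / 4.
Definition distracting_rate t := (\sum_(arr | distracting arr) law t arr) / 2.
Definition win_rate t := \sum_(arr | wins arr) law t arr + 2 * contested_rate t.

Lemma contested_rate_ge0 t : 0 <= contested_rate t.
Proof. by rewrite divr_ge0// sumr_ge0. Qed.

Lemma distracting_rate_ge0 t : 0 <= distracting_rate t.
Proof. by rewrite divr_ge0// sumr_ge0. Qed.

Lemma contested_rate_le t : 2 * contested_rate t <= win_rate t.
Proof. by rewrite lerDr sumr_ge0. Qed.

Lemma sum_law_split t (A B C D : R) :
  \sum_arr law t arr * (if wins arr then A else if contested arr then B
                        else if distracting arr then C else D) =
  (\sum_arr law t arr) * D + (\sum_(arr | wins arr) law t arr) * (A - D)
  + 4 * contested_rate t * (B - D) + 2 * distracting_rate t * (C - D).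
Proof.
rewrite /contested_rate /distracting_rate mulrCA divff ?pnatr_eq0// mulr1.
rewrite [2 * _]mulrCA divff ?pnatr_eq0// mulr1.
rewrite (big_mkcond wins) (big_mkcond contested) (big_mkcond distracting)/=.
rewrite !mulr_suml -!big_split/=; apply: eq_bigr => -[[i [x k]]|] _ /=; last by ring.
rewrite /involves; case: (good i) => /=; last by case: (_ && _); ring.
have [<-|xk] /= := eqVneq x k; first by rewrite andbb; case: (x == _); ring.
have -> : (x == Some j) && (k == Some j) = false.
  by apply/negP => /andP[/eqP xj /eqP kj]; rewrite xj kj eqxx in xk.
by case: (_ || _); ring.
Qed.

Lemma win_rate_le1 t :
  win_rate t + contested_rate t + distracting_rate t <= 1.
Proof.
apply: le_trans (law_le1 t).
have := sum_law_split t 1 1 1 0; rewrite mulr0 add0r !subr0 !mulr1 => E.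
have : \sum_arr law t arr * (if wins arr then 1 else if contested arr then 1
    else if distracting arr then 1 else 0) <= \sum_arr law t arr.
  by apply: ler_sum => arr _; do 3?case: ifP => _; rewrite ?mulr1// mulr0.
rewrite E /win_rate; have := contested_rate_ge0 t; have := distracting_rate_ge0 t.
by lra.
Qed.

Lemma mark_weight_le s c : losing c ->
  mark_weight K law s c <=
  mark_bound (fresh_weight R K win_rate contested_rate distracting_rate s)
    (armed_weight R K win_rate contested_rate distracting_rate s)
    (settled_weight R K win_rate s) (c (Some j)).
Proof.
elim: s c => [|t s IH] c lc.
  by rewrite /settled_weight big_nil /=; case: (c _).
have /andP[F0 _] := fresh_weight_bounds _ _ _ _ _ contested_rate_ge0
  distracting_rate_ge0 win_rate_le1 _ distracting_rate_ge0 (fun=> lexx _) s.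
have /andP[A0 _] := armed_weight_bounds _ _ _ _ _ contested_rate_ge0
  distracting_rate_ge0 win_rate_le1 _ distracting_rate_ge0 (fun=> lexx _) s.
have S0 := settled_weight_ge0 _ _ _ _ _ contested_rate_ge0
  distracting_rate_ge0 win_rate_le1 s.
apply: le_trans (ler_sum _ (fun arr _ => ler_wpM2l (law_ge0 t arr)
  (arrival_value_le _ _ _ _ (mark_weight_blur K law s) IH F0 A0 S0 c arr lc))) _.
(* Collecting terms with [y = p + 2q], where [p] is the mass of [wins], yields the coefficients
   [1 - y - q - b], [q] and [b] of the weight recursions. *)
rewrite sum_law_split settled_weight_cons /=.
move: F0 A0 S0 (law_le1 t); rewrite /win_rate.
move: (fresh_weight _ _ _ _ _ s) (armed_weight _ _ _ _ _ s) (settled_weight _ _ _ s).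
move: (\sum_arr law t arr) (\sum_(arr | wins arr) law t arr).
move: (contested_rate t) (distracting_rate t) => q b L p F A S F0 A0 S0 L1.
case: (c (Some j)) => [|x||] /=.
- by have := ler_wpM2r F0 L1; lra.
- by have := ler_wpM2r A0 L1; lra.
- by have := ler_wpM2r S0 L1; lra.
- by have := ler_wpM2r S0 L1; lra.
Qed.

End MarkWeightBound.

End RunWeight.

(** * The type decomposition *)

Section HalfUniform.
Variable R : realType.
Local Open Scope classical_set_scope.

Definition half_uniform (A : set R) : R := fine (uniform_prob (Defs.half_gt0 R) A).

Lemma half_uniform_ge0 A : 0 <= half_uniform A.
Proof.
apply: fine_ge0; apply: integral_ge0 => x _.
by rewrite lee_fin uniform_pdf_ge0 ?Defs.half_gt0.
Qed.

Lemma half_uniform_le1 A : measurable A -> half_uniform A <= 1.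
Proof.
move=> mA; rewrite -lee_fin /half_uniform fineK ?fin_num_measure//.
exact: probability_le1.
Qed.

Lemma half_uniform_bigcup (A : finType) (F : A -> set R) :
  (forall a, measurable (F a)) ->
  (forall a b x, F a x -> F b x -> a = b) ->
  half_uniform (\bigcup_a F a) = \sum_a half_uniform (F a).
Proof.
move=> mF tF; rewrite /half_uniform sum_fine => [|a _]; last first.
  by apply: fin_num_measure; exact: mF.
congr fine; rewrite measure_fin_bigcup//.
- rewrite fsbig_finite; last exact: finite_finset.
  rewrite (perm_big (index_enum A))//=.
  apply: uniq_perm; rewrite ?index_enum_uniq ?finmap.fset_uniq// => a.
  by rewrite mem_index_enum in_fset_set ?in_setT//; exact: finite_finset.
- exact: finite_finset.
- apply/trivIsetP => a b _ _ ab; rewrite -subset0 => x [Fa Fb].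
  by move: ab; rewrite (tF _ _ _ Fa Fb) eqxx.
- by move=> a _; exact: mF.
Qed.

(** The density is 2 on [[0, 1/2]] and 0 elsewhere, so [A] matters only there; the maximum covers an
    empty interval. *)
Lemma half_uniform_itv (A : set R) (l r : R) : 0 <= l -> r <= 2^-1 ->
  (forall x, 0 <= x <= 2^-1 -> A x <-> l <= x < r) ->
  half_uniform A = 2 * Num.max 0 (r - l).
Proof.
move=> l0 r2 hA; rewrite /half_uniform /uniform_prob integral_uniform_pdf.
have -> : A `&` `[0, 2^-1] = `[l, r[.
  apply/seteqP; split=> x /=; rewrite !in_itv/=.
    by move=> [Ax hx]; apply/hA.
  move=> /andP[lx xr]; have hx : 0 <= x <= 2^-1.
    by rewrite (le_trans l0 lx) (le_trans (ltW xr) r2).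
  by split=> //; apply/hA => //; apply/andP.
rewrite (eq_integral (cst 2%:E)); last first.
  move=> x; rewrite inE/= in_itv/= => /andP[lx xr].
  by rewrite /uniform_pdf (le_trans l0 lx) (le_trans (ltW xr) r2) subr0 invrK.
rewrite integral_cst//= lebesgue_measure_itv/= lte_fin.
case: ltP => lr /=; first by rewrite max_r// subr_ge0 ltW.
by rewrite max_l ?subr_le0// !mulr0.
Qed.

End HalfUniform.

Section TypeDecomposition.
Variables (R : realType) (J : finType) (ord : seq J) (m : J -> R).
Hypothesis ord_enum : perm_eq ord (enum J).
Hypothesis m_ge0 : forall j, 0 <= m j.
Hypothesis m_le1 : \sum_j m j <= 1.

Let cum k : R := \sum_(j <- take k ord) m j.

Let ord_uniq : uniq ord.
Proof. by rewrite (perm_uniq ord_enum) enum_uniq. Qed.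

Let mem_ord j : j \in ord.
Proof. by rewrite (perm_mem ord_enum) mem_enum. Qed.

Let cum_size : cum (size ord) = \sum_j m j.
Proof. by rewrite /cum take_size (perm_big _ ord_enum) big_enum. Qed.

Let cumS j : cum (index j ord).+1 = cum (index j ord) + m j.
Proof.
rewrite /cum (take_nth j) ?index_mem// -cats1 big_cat big_seq1 /=.
by rewrite nth_index.
Qed.

Let cum_mono k l : (k <= l)%N -> cum k <= cum l.
Proof.
move=> kl; rewrite /cum -(subnKC kl) takeD big_cat/= lerDl.
exact: sumr_ge0.
Qed.

Let cum_ge0 k : 0 <= cum k. Proof. exact: sumr_ge0. Qed.

Let cum_le1 k : cum k <= 1.
Proof.
apply: le_trans m_le1; rewrite -cum_size; case: (leqP k (size ord)) => hk.
  exact: cum_mono.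
by rewrite /cum !take_oversize// ltnW.
Qed.

Lemma agent_interval_inj a b (x : R) :
  x \in agent_interval ord m a -> x \in agent_interval ord m b -> a = b.
Proof.
have lt_agents j k : (index j ord < index k ord)%N ->
    x \in agent_interval ord m (Some j) -> x \in agent_interval ord m (Some k) -> False.
  move=> jk; rewrite !in_itv/= -!/(cum _) -cumS => /andP[_ xj] /andP[kx _].
  by have := cum_mono _ _ jk; lra.
have dummy j : x \in agent_interval ord m (Some j) ->
    x \in agent_interval ord m None -> False.
  rewrite !in_itv/= -!/(cum _) -cumS => /andP[_ xj] /andP[kx _].
  have hj : (index j ord < size ord)%N by rewrite index_mem.
  have := cum_mono _ _ hj; move: kx; rewrite -[ord in \sum_(_ <- ord) _]take_size -/(cum _).
  by lra.
case: a b => [j|] [k|] //.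
- case: (ltngtP (index j ord) (index k ord)) => [jk|kj|e] hj hk.
  + by case: (lt_agents _ _ jk hj hk).
  + by case: (lt_agents _ _ kj hk hj).
  + by rewrite -(nth_index j (mem_ord k)) -e nth_index.
- by move=> h1 h2; case: (dummy _ h1 h2).
- by move=> h1 h2; case: (dummy _ h2 h1).
Qed.

Lemma agent_interval_cover (x : R) : 0 <= x < 1 ->
  exists a, x \in agent_interval ord m a.
Proof.
move=> /andP[x0 x1]; case: (leP (cum (size ord)) x) => hx.
  by exists None; rewrite in_itv/= x1 andbT -[ord in \sum_(_ <- ord) _]take_size.
have ex : exists k, x < cum k by exists (size ord).
(* The least [k] with [x < cum k] is one more than the position of the agent sought. *)
case: (ex_minnP ex) => -[|k] xk kmin; first by move: xk; rewrite /cum take0 big_nil ltNge x0.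
have kx : cum k <= x by rewrite leNgt; apply/negP => /kmin; rewrite ltnn.
have ks : (k < size ord)%N := kmin _ hx.
have [j0 _] : exists j0 : J, True by case: (ord) ks => // j0; exists j0.
exists (Some (nth j0 ord k)); rewrite in_itv/= -/(cum _) -cumS index_uniq//.
by rewrite kx xk.
Qed.

Let lo a : R := if a is Some j then cum (index j ord) else cum (size ord).
Let hi a : R := if a is Some j then cum (index j ord) + m j else 1.

Let mem_agent_interval a (x : R) : (x \in agent_interval ord m a) = (lo a <= x < hi a).
Proof.
by case: a => [j|]; rewrite in_itv//= -[ord in \sum_(_ <- ord) _]take_size.
Qed.

Let lo_ge0 a : 0 <= lo a. Proof. by case: a => [j|]; exact: cum_ge0. Qed.

Let hi_le1 a : hi a <= 1. Proof. by case: a => [j|] //=; rewrite -cumS. Qed.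

Let cell (ab : option J * option J) : set R :=
  [set eta : R | eta \in agent_interval ord m ab.1
              /\ eta + 2^-1 \in agent_interval ord m ab.2]%classic.

Let cellE ab x :
  cell ab x <-> lo ab.1 <= x < hi ab.1 /\ lo ab.2 <= x + 2^-1 < hi ab.2.
Proof. by rewrite /cell /mkset !mem_agent_interval. Qed.

Let measurable_cell ab : measurable (cell ab).
Proof.
have -> : cell ab = (`[lo ab.1, hi ab.1[ `&` `[lo ab.2 - 2^-1, hi ab.2 - 2^-1[)%classic.
  apply/seteqP; split=> x; rewrite cellE /setI /mkset !in_itv/=.
    by move=> [-> /andP[? ?]]; split => //; apply/andP; split; lra.
  by move=> [-> /andP[? ?]]; split => //; apply/andP; split; lra.
by apply: measurableI; exact: measurable_itv.
Qed.

Lemma type_decomposition_ge0 ab : 0 <= type_decomposition ord m ab.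
Proof. exact: half_uniform_ge0. Qed.

Lemma sum_type_decomposition_le1 : \sum_ab type_decomposition ord m ab <= 1.
Proof.
rewrite -(half_uniform_bigcup _ _ cell)//.
  by apply: half_uniform_le1; apply: fin_bigcup_measurable.
move=> [a b] [a' b'] x [/= xa xb] [/= xa' xb'].
by rewrite (agent_interval_inj _ _ _ xa xa') (agent_interval_inj _ _ _ xb xb').
Qed.

Lemma type_decomposition_diag j :
  type_decomposition ord m (Some j, Some j) = 2 * Num.max 0 (m j - 2^-1).
Proof.
have := lo_ge0 (Some j); have := hi_le1 (Some j); rewrite /= => h1 h0.
rewrite [LHS](half_uniform_itv _ (cell (Some j, Some j))
  (cum (index j ord)) (cum (index j ord) + m j - 2^-1))//; [|lra|].
  by congr (2 * Num.max _ _); ring.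
move=> x /andP[x0 x1]; rewrite cellE /=.
split=> [[/andP[? ?] /andP[? ?]]|/andP[? ?]]; first by apply/andP; split; lra.
by split; apply/andP; split; lra.
Qed.

Lemma sum_type_decomposition_row j :
  \sum_b type_decomposition ord m (Some j, b) =
  2 * Num.max 0 (Num.min (cum (index j ord) + m j) 2^-1 - cum (index j ord)).
Proof.
rewrite -(half_uniform_bigcup _ _ (fun b => cell (Some j, b)))//; last first.
  by move=> b b' x [/= _ xb] [/= _ xb']; exact: agent_interval_inj xb xb'.
apply: half_uniform_itv; [exact: cum_ge0|by rewrite ge_min lexx orbT|].
move=> x /andP[x0 x1]; rewrite lt_min; split=> [[b _ /cellE[/=]]|].
  move=> /andP[-> ->] /andP[_ xb].
  by have := hi_le1 b; lra.
move=> /and3P[lx xr x2]; have [|b xb] := agent_interval_cover (x + 2^-1).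
  by apply/andP; split; lra.
exists b => //; split; last exact: xb.
by rewrite mem_agent_interval /= lx.
Qed.

Lemma sum_type_decomposition_col j :
  \sum_a type_decomposition ord m (a, Some j) =
  2 * Num.max 0 (cum (index j ord) + m j - 2^-1
                 - Num.max 0 (cum (index j ord) - 2^-1)).
Proof.
rewrite -(half_uniform_bigcup _ _ (fun a => cell (a, Some j)))//; last first.
  by move=> a a' x [/= xa _] [/= xa' _]; exact: agent_interval_inj xa xa'.
apply: half_uniform_itv.
- by rewrite le_max lexx.
- by have := hi_le1 (Some j); rewrite /=; lra.
move=> x /andP[x0 x1]; rewrite ge_max x0; split=> [[a _ /cellE[/= _]]|].
  by move=> /andP[? ?]; apply/andP; split; lra.
move=> /andP[/= lx xr]; have [|a xa] := agent_interval_cover x.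
  by apply/andP; split; lra.
exists a => //; split; first exact: xa.
by rewrite mem_agent_interval/=; apply/andP; split; lra.
Qed.

(** The first coordinate sees the part of the agent's interval below [1/2], the second the part
    above, both with density 2. *)
Lemma sum_type_decomposition_agent j :
  \sum_b type_decomposition ord m (Some j, b)
  + \sum_a type_decomposition ord m (a, Some j) = 2 * m j.
Proof.
rewrite sum_type_decomposition_row sum_type_decomposition_col -mulrDr.
congr (2 * _); move: (m_ge0 j) (cum _) => mj c.
by rewrite /Num.max /Num.min; do ![case: ifP => /=]; lra.
Qed.

(** The diagonal cell is counted in both the row and the column of the agent. *)
Lemma sum_type_decomposition_involves j :
  \sum_(ab | involves J j ab.1 ab.2) type_decomposition ord m ab
  = 2 * (m j - type_decomposition ord m (Some j, Some j)).
Proof.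
rewrite mulrBr -sum_type_decomposition_agent.
set F := type_decomposition ord m.
have row : \sum_b F (Some j, b) = \sum_ab (if ab.1 == Some j then F ab else 0).
  transitivity (\sum_a \sum_b (if a == Some j then F (a, b) else 0)); last first.
    by rewrite pair_bigA; apply: eq_bigr => -[].
  rewrite [RHS](bigD1 (Some j))//= eqxx [X in _ + X]big1 ?addr0// => a /negbTE aj.
  by rewrite aj big1.
have col : \sum_a F (a, Some j) = \sum_ab (if ab.2 == Some j then F ab else 0).
  transitivity (\sum_a \sum_b (if b == Some j then F (a, b) else 0)); last first.
    by rewrite pair_bigA; apply: eq_bigr => -[].
  by apply: eq_bigr => a _; rewrite -big_mkcond big_pred1_eq.
have diag : 2 * F (Some j, Some j) =
    \sum_ab (if ab == (Some j, Some j) then 2 * F ab else 0).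
  by rewrite -big_mkcond big_pred1_eq.
rewrite row col diag -big_split -sumrB big_mkcond/=; apply: eq_bigr => -[a b] _ /=.
rewrite xpair_eqE /involves; have [->|ab] := eqVneq a b; case: (eqVneq b (Some j)) => [bj|bj] /=.
- by ring.
- by ring.
- by rewrite -bj (negbTE ab) /=; ring.
- by rewrite orbF ?andbF; case: ifP => _; ring.
Qed.

End TypeDecomposition.

(** * Arrivals *)

Lemma sum_option (R : realType) (A : finType) (F : option A -> R) :
  \sum_a F a = F None + \sum_a F (Some a).
Proof.
rewrite (bigD1 None)//=; congr (_ + _).
by rewrite (reindex_omap Some id) => [|[]]//; apply: eq_bigl => a; rewrite eqxx.
Qed.

Section ArrivalLaw.
Variables (R : realType) (I J : finType) (T : nat).
Variables (f : 'I_T -> I -> R) (mu : 'I_T -> I -> J -> R) (ord : seq J).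
Hypothesis hf : arrival_rates f.
Hypothesis hord : perm_eq ord (enum J).
Hypothesis hmu : forall t i j, 0 <= mu t i j.
Hypothesis hx : matching_lp_feasible f (fun t i j => f t i * mu t i j).
Variables (j : J) (good : pred I).

Definition arrival_law (t : 'I_T) (arr : option (I * (option J * option J))) : R :=
  if arr is Some (i, ab) then f t i * type_decomposition ord (mu t i) ab
  else 1 - \sum_i f t i.

Let f_ge0 t i : 0 <= f t i. Proof. by case: hf. Qed.

Lemma arrival_law_ge0 t arr : 0 <= arrival_law t arr.
Proof.
case: arr => [[i ab]|] /=; last by rewrite subr_ge0; case: hf.
by rewrite mulr_ge0// type_decomposition_ge0.
Qed.

(* The fractional allocation of a type that never arrives is unconstrained. *)
Lemma mass_le1 t i : f t i = 0 \/ \sum_k mu t i k <= 1.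
Proof.
have [f0|f0] := eqVneq (f t i) 0; [by left|right].
case: hx => /(_ t i) + _ _; rewrite -mulr_sumr.
by rewrite -[leRHS]mulr1 ler_pM2l// lt_def f0 f_ge0.
Qed.

Lemma sum_arrival_law (P : pred (option (I * (option J * option J)))) t :
  ~~ P None ->
  \sum_(arr | P arr) arrival_law t arr =
  \sum_i f t i * \sum_(ab | P (Some (i, ab))) type_decomposition ord (mu t i) ab.
Proof.
move=> /negbTE PN; rewrite big_mkcond sum_option PN add0r.
under [RHS]eq_bigr do rewrite mulr_sumr big_mkcond.
by rewrite pair_bigA; apply: eq_bigr => -[i ab] _.
Qed.

Lemma arrival_law_le1 t : \sum_arr arrival_law t arr <= 1.
Proof.
rewrite sum_option -[X in _ <= X](subrK (\sum_i f t i)) lerD2l.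
have -> : \sum_p arrival_law t (Some p) =
    \sum_i \sum_ab f t i * type_decomposition ord (mu t i) ab.
  by rewrite pair_bigA; apply: eq_bigr => -[].
apply: ler_sum => i _; rewrite -mulr_sumr.
case: (mass_le1 t i) => [->|m1]; first by rewrite mul0r.
by rewrite -[leRHS]mulr1 ler_wpM2l// sum_type_decomposition_le1.
Qed.

Local Notation diag t i := (type_decomposition ord (mu t i) (Some j, Some j)).

Lemma sum_wins t : \sum_(arr | wins I J j good arr) arrival_law t arr =
  \sum_(i | good i) f t i * diag t i.
Proof.
rewrite sum_arrival_law// [RHS]big_mkcond; apply: eq_bigr => i _ /=.
case: (good i) => /=; last by rewrite big_pred0 ?mulr0// => -[].
by rewrite (big_pred1 (Some j, Some j))// => -[x k]; rewrite /= -xpair_eqE.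
Qed.

Lemma sum_involved t i :
  f t i * \sum_(ab | involves J j ab.1 ab.2) type_decomposition ord (mu t i) ab =
  2 * (f t i * (mu t i j - diag t i)).
Proof.
case: (mass_le1 t i) => [->|m1]; first by rewrite !mul0r mulr0.
by rewrite sum_type_decomposition_involves// mulrCA.
Qed.

Lemma sum_contested t : \sum_(arr | contested I J j good arr) arrival_law t arr =
  2 * \sum_(i | good i) f t i * (mu t i j - diag t i).
Proof.
rewrite sum_arrival_law// mulr_sumr [RHS]big_mkcond; apply: eq_bigr => i _ /=.
case: (good i) => /=; last by rewrite big_pred0 ?mulr0// => -[].
by rewrite -sum_involved; congr (_ * _); apply: eq_bigl => -[].
Qed.

Lemma sum_distracting t : \sum_(arr | distracting I J j good arr) arrival_law t arr =
  2 * \sum_(i | ~~ good i) f t i * (mu t i j - diag t i).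
Proof.
rewrite sum_arrival_law// mulr_sumr [RHS]big_mkcond; apply: eq_bigr => i _ /=.
case: (good i) => /=; first by rewrite big_pred0 ?mulr0// => -[].
by rewrite -sum_involved; congr (_ * _); apply: eq_bigl => -[].
Qed.

Local Notation wr := (win_rate R I J j good 'I_T arrival_law).
Local Notation cr := (contested_rate R I J j good 'I_T arrival_law).
Local Notation dr := (distracting_rate R I J j good 'I_T arrival_law).

(** The decomposition preserves marginals: the one-way mass plus half of the two-way mass is the
    fractional allocation. *)
Lemma win_rateE t : wr t = \sum_(i | good i) f t i * mu t i j.
Proof.
rewrite /win_rate /contested_rate sum_wins sum_contested.
set A := \sum_(i | good i) _ * (_ - _).
have -> : 2 * (2 * A / 4) = A by field.
by rewrite -big_split/=; apply: eq_bigr => i _; ring.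
Qed.

Lemma distracting_rate_le_mass t : dr t <= \sum_(i | ~~ good i) f t i * mu t i j.
Proof.
rewrite /distracting_rate sum_distracting mulrC mulKf ?pnatr_eq0//.
apply: ler_sum => i _; rewrite ler_wpM2l// gerBl.
exact: type_decomposition_ge0.
Qed.

Local Notation heavy t i := (good i && (2^-1 <= mu t i j)).

(** The left side is the relevant one-way mass, to which a type contributes [f (2 mu - 1)] if
    [mu >= 1/2] and nothing otherwise. *)
Lemma heavy_excess t : wr t - 2 * cr t =
  2 * (\sum_(i | heavy t i) f t i * mu t i j) - \sum_(i | heavy t i) f t i.
Proof.
rewrite /win_rate addrK sum_wins mulr_sumr -sumrB big_mkcondr/=.
apply: eq_bigr => i _; case: (mass_le1 t i) => [->|m1].
  by rewrite !mul0r mulr0 subr0 if_same.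
rewrite type_decomposition_diag//.
case: leP => h; first by rewrite max_r ?subr_ge0//; field.
by rewrite max_l ?subr_le0 ?ltW// !mulr0.
Qed.

Lemma fresh_weight_arrival_le_g :
  fresh_weight R 'I_T wr cr dr (enum 'I_T)
    <= g_bound (\sum_t \sum_(i | good i) f t i * mu t i j).
Proof.
case: hx => _ lp _; case: hf => _ f_le1.
have big_enumT (F : 'I_T -> R) : \sum_(t <- enum 'I_T) F t = \sum_t F t.
  by rewrite big_enum.
have -> : \sum_t \sum_(i | good i) f t i * mu t i j = \sum_(t <- enum 'I_T) wr t.
  by rewrite big_enumT; apply: eq_bigr => t _; rewrite win_rateE.
have ge0 := arrival_law_ge0; have le1 := arrival_law_le1.
apply: (fresh_weight_le_g _ _ _ _ _ (fun t => \sum_(i | heavy t i) f t i)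
  (fun t => \sum_(i | heavy t i) f t i * mu t i j)).
- exact: contested_rate_ge0.
- exact: contested_rate_le.
- exact: distracting_rate_ge0.
- exact: win_rate_le1.
- by move=> t; exact: sumr_ge0.
- move=> t; apply: le_trans (f_le1 t); rewrite [leLHS]big_mkcond.
  by apply: ler_sum => i _; case: ifP.
- move=> t; rewrite mulr_sumr; apply: ler_sum => i /andP[_ h].
  by rewrite mulrCA -[leLHS]mulr1 ler_wpM2l//; lra.
- move=> t; rewrite win_rateE big_mkcondr; apply: ler_sum => i _.
  by case: ifP => // _; rewrite mulr_ge0.
- by move=> t; rewrite heavy_excess.
(* The LP constraint for the heavy pairs is the one that limits the one-way mass. *)
- have := lp j [set ti | heavy ti.1 ti.2].
  rewrite big_enumT big_enum/= => h.
  rewrite pair_big_dep/=; apply: le_trans (le_trans _ h) _.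
    by rewrite le_eqVlt; apply/orP; left; apply/eqP/eq_bigl => ti; rewrite inE.
  rewrite lerD2l lerN2 le_eqVlt; apply/orP; left; apply/eqP.
  apply: eq_bigr => t _; congr (1 - _).
  by apply: eq_bigl => i; rewrite inE.
- rewrite !big_enumT.
  apply: le_trans (_ : \sum_t \sum_i f t i * mu t i j <= _).
    rewrite -big_split/=; apply: ler_sum => t _.
    rewrite [leRHS](bigID good)/= win_rateE lerD2l.
    exact: distracting_rate_le_mass.
  (* The constraint for all pairs bounds the total mass of the agent by 1, which leaves at most
     [1 - y] for irrelevant types. *)
  have := lp j [set: 'I_T * I]; rewrite pair_bigA/= => h.
  apply: le_trans (le_trans _ h) _; first by rewrite le_eqVlt; apply/orP; left; apply/eqP/eq_bigl => ti; rewrite inE.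
  rewrite gerBl; apply: prodr_ge0 => t _; rewrite subr_ge0.
  by apply: le_trans (f_le1 t); rewrite [leLHS]big_mkcond; apply: ler_sum => i _; case: ifP.
Qed.

End ArrivalLaw.

Theorem theorem6p5 (R : realType) (I J : finType) (T : nat)
    (f : 'I_T -> I -> R) (w : I -> J -> R) (mu : 'I_T -> I -> J -> R)
    (ord : seq J)
    (hf : arrival_rates f)
    (hw : forall i j, 0 <= w i j)
    (hord : perm_eq ord (enum J))
    (hmu : forall t i j, 0 <= mu t i j)
    (hx : matching_lp_feasible f (fun t i j => f t i * mu t i j)) :
  forall (j : J) (v : R), 0 < v ->
    socs_prob f mu ord (unallocated_above w j v)
      <= g_bound (mass_above f mu w j v).
Proof.
move=> j v _; pose good := [pred i | v <= w i j].
have unallocatedE rs : unallocated_above w j v rs = all (misses I J j good) rs.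
  apply/forallP/allP => [h [[i a]|]//= ria|h i].
    apply/negP => /andP[vw /eqP aj]; have := h i; rewrite vw /= -aj.
    by rewrite ria.
  by apply/implyP => vw; apply/negP => /h /=; rewrite vw eqxx.
have -> : socs_prob f mu ord (unallocated_above w j v) =
    mark_weight R I J j good 'I_T (arrival_law R I J T f mu ord) (enum 'I_T)
      (fun=> Unmarked).
  rewrite -(run_weight_mark R I J j good 'I_T (arrival_law R I J T f mu ord)
    (enum 'I_T) (@socs_init J)) -sum_run_weight /socs_prob.
  under eq_bigl do rewrite unallocatedE.
  apply: eq_bigr => os _; apply: eq_bigr => t _.
  by case: (tnth os t) => -[arr mc] sc.
(* Initially every mark is [Unmarked]: this state satisfies [losing], and its bound is the fresh
   weight. *)
apply: le_trans (mark_weight_le R I J j good 'I_T _ _ _ _ _ _) _ => //.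
- by move=> t arr; exact: arrival_law_ge0.
- by move=> t; exact: arrival_law_le1.
- exact: fresh_weight_arrival_le_g.
Qed.
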